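(* Let $m \ge 2$ and $p\ge 1$ be integers. The set of $m$-output linear systems representable by the ARMA$(p,p)$-irreducible parametrization, i.e. the set of all systems whose Kronecker indices satisfy $\max\{n_1,\dots,n_m\} = p$, regarded as a subset of the Hilbert space of linear systems, does not constitute a differentiable manifold.
   Context: A linear system (with $m$ inputs and $m$ outputs) is identified with its sequence $\{H_i\}_{i\ge 0}$ of real $m\times m$ Markov parameters, or equivalently its transfer function $H(z)=\sum_{i\ge 0} H_i z^{-i}$, which is a rational matrix. Here $H_0 = I$, and the system is stable (all poles in the open unit disc). Systems are points of the Hilbert space of square-summable sequences of $m\times m$ matrices with inner product $\langle s_1,s_2\rangle = \mathrm{tr}\big[\sum_{i\ge 0} H_i^{(1)}(H_i^{(2)})^T\big]$. ''Differentiable manifold'' for a set of systems is meant as a submanifold of this space. Kronecker indices: let $\mathcal{H}$ be the infinite block Hankel matrix whose $(i,j)$ block ($i,j\ge 1$) is $H_{i+j-1}$. Scan the rows of $\mathcal H$ from top to bottom, retaining a row if and only if it is linearly independent of the preceding rows. The Kronecker index $n_i$ ($i=1,\dots,m$) is the number of retained rows that are the $i$-th row of some block row (i.e. correspond to the $i$-th component of $y$). ARMA$(p,p)$-irreducible parametrization: the models $y_t + A_1 y_{t-1} + \dots + A_p y_{t-p} = \varepsilon_t + B_1\varepsilon_{t-1} + \dots + B_p \varepsilon_{t-p}$ with $m\times m$ real matrices $A_i,B_i$ (all in principle full), where $p$ cannot be reduced. They represent exactly the systems with $\max_i n_i = p$. The transfer function of such a model is $H(z)=A(z)^{-1}B(z)$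 with $A(z)=I+A_1z^{-1}+\dots+A_pz^{-p}$, $B(z)=I+B_1z^{-1}+\dots+B_pz^{-p}$. *)

(* Defs.v *)
From HB Require Import structures.
From mathcomp Require Import all_boot all_order all_algebra complex.
From mathcomp Require Import ring lra.
From mathcomp Require Import all_classical all_reals all_analysis.

Set Implicit Arguments.
Unset Strict Implicit.
Unset Printing Implicit Defensive.

Import Order.TTheory GRing.Theory Num.Theory.
Import numFieldNormedType.Exports.

Local Open Scope classical_set_scope.
Local Open Scope ring_scope.

Section FrobeniusProduct.
Context {R : realType} {m : nat}.
Implicit Types (A B C : 'M[R]_m) (a : R).

Definition frob A B : R := \tr (A *m B^T).

Lemma frobE A B : frob A B = \sum_i \sum_j A i j * B i j.
Proof.
apply: eq_bigr => i _; rewrite !mxE; apply: eq_bigr => j _.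
by rewrite !mxE.
Qed.

Lemma frobC A B : frob A B = frob B A.
Proof. by rewrite /frob -mxtrace_tr trmx_mul trmxK. Qed.

Lemma frobDl A B C : frob (A + B) C = frob A C + frob B C.
Proof. by rewrite /frob mulmxDl mxtraceD. Qed.

Lemma frobZl a A B : frob (a *: A) B = a * frob A B.
Proof. by rewrite /frob -scalemxAl mxtraceZ. Qed.

Lemma frobDr A B C : frob A (B + C) = frob A B + frob A C.
Proof. by rewrite frobC frobDl !(frobC A). Qed.

Lemma frobZr a A B : frob A (a *: B) = a * frob A B.
Proof. by rewrite frobC frobZl frobC. Qed.

Lemma frob_ge0 A : 0 <= frob A A.
Proof.
by rewrite frobE; do 2![apply: sumr_ge0 => ? _]; rewrite -expr2 sqr_ge0.
Qed.

Lemma frob_eq0 A : frob A A = 0 -> A = 0.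
Proof.
rewrite frobE => /psumr_eq0P A0; apply/matrixP => i j; rewrite mxE.
have ge0 k l : 0 <= A k l * A k l by rewrite -expr2 sqr_ge0.
have /psumr_eq0P Ai0 := A0 (fun k _ => sumr_ge0 _ (fun l _ => ge0 k l)) i isT.
by have /eqP := Ai0 (fun l _ => ge0 i l) j isT; rewrite mulf_eq0 orbb => /eqP.
Qed.

Lemma frob_norm_le A B : `|frob A B| <= frob A A + frob B B.
Proof.
have := frob_ge0 (A + B); have := frob_ge0 (A + (-1) *: B).
have := frob_ge0 A; have := frob_ge0 B.
rewrite !(frobDl, frobDr, frobZl, frobZr) (frobC B A).
by move=> b0 a0 h1 h2; rewrite ler_norml; apply/andP; split; lra.
Qed.

End FrobeniusProduct.

Section SquareSummable.
Context {R : realType} {m : nat}.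
Implicit Types (H G : nat -> 'M[R]_m).

Definition sq_summable : pred (nat -> 'M[R]_m) :=
  fun H => `[< cvgn (series (fun i => frob (H i) (H i))) >].

Lemma cvg_frob H G : H \in sq_summable -> G \in sq_summable ->
  cvgn (series (fun i => frob (H i) (G i))).
Proof.
move=> /asboolP cH /asboolP cG; apply: normed_cvg.
apply: (@series_le_cvg _ _ (fun i => frob (H i) (H i) + frob (G i) (G i))).
- by move=> n; rewrite normr_ge0.
- by move=> n; rewrite addr_ge0 ?frob_ge0.
- by move=> n; exact: frob_norm_le.
- exact: is_cvg_seriesD.
Qed.

Lemma sq_summable_submod_closed : submod_closed sq_summable.
Proof.
split.
  apply/asboolP; rewrite (_ : series _ = cst 0); first exact: is_cvg_cst.
  by apply/funext => n; rewrite /series /= big1// => i _; rewrite frobE big1// => j _;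
    rewrite big1// => k _; rewrite mxE mul0r.
move=> a H G hH hG; apply/asboolP.
rewrite (_ : (fun i => _) = (a ^+ 2) *: (fun i => frob (H i) (H i)) +
   ((2 * a) *: (fun i => frob (H i) (G i)) + (fun i => frob (G i) (G i)))).
  apply: is_cvg_seriesD; first by apply: is_cvg_seriesZ; exact: cvg_frob.
  apply: is_cvg_seriesD; last exact: cvg_frob.
  by apply: is_cvg_seriesZ; exact: cvg_frob.
apply/funext => i.
rewrite !fctE !(frobDl, frobDr, frobZl, frobZr) (frobC (G i) (H i)).
by rewrite /GRing.scale/=; ring.
Qed.

HB.instance Definition _ :=
  GRing.isSubmodClosed.Build R (nat -> 'M[R]_m) sq_summable
    sq_summable_submod_closed.

End SquareSummable.

(* Square-summable sequences of m x m matrices; the norm and topology below are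
   those of the inner product l2dot. *)
Record l2 (R : realType) (m : nat) := L2 {
  markov :> nat -> 'M[R]_m ;
  _ : markov \in sq_summable }.

HB.instance Definition _ (R : realType) (m : nat) :=
  [isSub for @markov R m].
HB.instance Definition _ (R : realType) (m : nat) :=
  [Choice of l2 R m by <:].
HB.instance Definition _ (R : realType) (m : nat) :=
  [SubChoice_isSubLmodule of l2 R m by <:].

Section L2.
Context {R : realType} {m : nat}.
Implicit Types (s t u : l2 R m) (a : R).

Definition l2dot s t : R := limn (series (fun i => \tr (s i *m (t i)^T))).

Definition l2norm s : R := Num.sqrt (l2dot s s).

Let cvg_l2 s t : cvgn (series (fun i => frob (s i) (t i))).
Proof. by apply: cvg_frob; exact: valP. Qed.

Lemma l2dotC s t : l2dot s t = l2dot t s.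
Proof.
by rewrite /l2dot; congr (limn (series _)); apply/funext => i; exact: frobC.
Qed.

Lemma l2dotDl s t u : l2dot (s + t) u = l2dot s u + l2dot t u.
Proof.
rewrite /l2dot -lim_seriesD; [|exact: cvg_l2|exact: cvg_l2].
by congr (limn (series _)); apply/funext => i; exact: frobDl.
Qed.

Lemma l2dotZl a s t : l2dot (a *: s) t = a * l2dot s t.
Proof.
have := lim_seriesZ a (@cvg_l2 s t); rewrite /GRing.scale/= => <-.
by rewrite /l2dot; congr (limn (series _)); apply/funext => i; exact: frobZl.
Qed.

Lemma l2dotDr s t u : l2dot s (t + u) = l2dot s t + l2dot s u.
Proof. by rewrite l2dotC l2dotDl !(l2dotC s). Qed.

Lemma l2dotZr a s t : l2dot s (a *: t) = a * l2dot s t.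
Proof. by rewrite l2dotC l2dotZl l2dotC. Qed.

Lemma frob_le_l2dot s i : frob (s i) (s i) <= l2dot s s.
Proof.
apply: (@le_trans _ _ (series (fun j => frob (s j) (s j)) i.+1)).
  rewrite /series /= big_nat_recr//= lerDr.
  by apply: sumr_ge0 => j _; exact: frob_ge0.
apply: (@nondecreasing_cvgn_le _ (series (fun j => frob (s j) (s j)))).
  apply/nondecreasing_seqP => n; rewrite /series /= big_nat_recr//= lerDl.
  exact: frob_ge0.
exact: cvg_l2.
Qed.

Lemma l2dot_ge0 s : 0 <= l2dot s s.
Proof. exact: le_trans (frob_ge0 _) (frob_le_l2dot s 0). Qed.

Lemma l2dot_le s t : l2dot s t <= l2norm s * l2norm t.
Proof.
have nn x : l2norm x ^+ 2 = l2dot x x by rewrite sqr_sqrtr// l2dot_ge0.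
have n0 x : 0 <= l2norm x by exact: sqrtr_ge0.
have CS : l2dot s t ^+ 2 <= l2dot s s * l2dot t t.
  have s0 := l2dot_ge0 s; have t0 := l2dot_ge0 t.
  set a := l2dot s s in s0 *; set b := l2dot t t in t0 *; set c := l2dot s t.
  have key x y : 0 <= x ^+ 2 * a + 2 * x * y * c + y ^+ 2 * b.
    have := l2dot_ge0 (x *: s + y *: t).
    rewrite !(l2dotDl, l2dotDr, l2dotZl, l2dotZr) (l2dotC t s) -/a -/b -/c.
    by move=> h; apply: le_trans h _; rewrite le_eqVlt; apply/orP; left;
       apply/eqP; ring.
  have [a0|a0] := eqVneq a 0.
    have : 0 <= - (c ^+ 4 * (b + 2)).
      apply: le_trans (key (- c * (b + 1)) (c ^+ 2)) _.
      by rewrite a0 le_eqVlt; apply/orP; left; apply/eqP; ring.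
    rewrite oppr_ge0 pmulr_lle0; last by lra.
    rewrite (_ : c ^+ 4 = (c ^+ 2) ^+ 2) ?a0 ?mul0r; last by rewrite -exprM.
    move=> c4; have : (c ^+ 2) ^+ 2 == 0 by rewrite eq_le c4 sqr_ge0.
    by rewrite sqrf_eq0 => /eqP ->.
  have ap : 0 < a by rewrite lt_def a0.
  have := key (- c) a => h.
  have : 0 <= a * (a * b - c ^+ 2) by apply: le_trans h _; rewrite le_eqVlt;
    apply/orP; left; apply/eqP; ring.
  by rewrite pmulr_rge0// subr_ge0.
apply: le_trans (ler_norm _) _; rewrite -sqrtr_sqr -sqrtrM ?l2dot_ge0//.
exact: ler_wsqrtr.
Qed.

Lemma l2norm_triangle s t : l2norm (s + t) <= l2norm s + l2norm t.
Proof.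
have nn x : l2norm x ^+ 2 = l2dot x x by rewrite sqr_sqrtr// l2dot_ge0.
have n0 x : 0 <= l2norm x by exact: sqrtr_ge0.
rewrite -(@ler_pXn2r _ 2)// ?nnegrE ?addr_ge0//.
rewrite nn sqrrD !nn !(l2dotDl, l2dotDr) (l2dotC t s).
have := l2dot_le s t; lra.
Qed.

Lemma l2normZ a s : l2norm (a *: s) = `|a| * l2norm s.
Proof.
rewrite /l2norm l2dotZl l2dotZr mulrA -expr2 sqrtrM ?sqr_ge0//.
by rewrite sqrtr_sqr.
Qed.

Lemma l2norm_eq0 s : l2norm s = 0 -> s = 0.
Proof.
move=> /eqP; rewrite sqrtr_eq0 => s0; apply/val_inj/funext => i.
apply: frob_eq0; apply/eqP; rewrite eq_le frob_ge0 andbT.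
exact: le_trans (frob_le_l2dot s i) s0.
Qed.

HB.instance Definition _ :=
  Lmodule_isNormed.Build R (l2 R m) l2norm_triangle l2normZ l2norm_eq0.

End L2.

Section LinearSystems.
Context {R : realType} {m : nat}.
Implicit Types (H : nat -> 'M[R]_m) (h : nat -> R) (N D : {poly R}).

(* D(z) * \sum_(i >= 0) h_i z^-i = N(z) as formal Laurent series in z^-1:
   the coefficients of z^k and of z^-(k+1) are compared for every k. *)
Definition transfer_fraction h N D : Prop :=
  (forall k, \sum_(k <= j < size D) D`_j * h (j - k)%N = N`_k) /\
  (forall k, \sum_(j < size D) D`_j * h (j + k.+1)%N = 0).

(* The poles are the complex roots of the denominator in lowest terms. *)
Definition stable_rational h : Prop :=
  exists N D, [/\ D != 0, coprimep N D, transfer_fraction h N D &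
    forall z : R[i], root (map_poly (real_complex R) D) z -> `|z| < 1].

(* The poles of a rational matrix are the poles of its entries. *)
Definition linear_systems : set (l2 R m) :=
  [set s | s 0%N = 1%:M /\ forall a b, stable_rational (fun i => s i a b)].

(* Blocks are indexed from 0, so that block (i, j) is H_(i+j+1). *)
Definition hankel H (i j : nat) : 'M[R]_m := H (i + j).+1.

Definition hankel_row H (i : nat) (a : 'I_m) : nat -> 'rV[R]_m :=
  fun j => row a (hankel H i j).

Definition depends_on_preceding_rows H (i : nat) (a : 'I_m) : Prop :=
  exists c : nat -> 'I_m -> R,
    hankel_row H i a =
      \sum_(k < i) \sum_(b < m) c k b *: hankel_row H k b
      + \sum_(b < m | (b < a)%N) c i b *: hankel_row H i b.

Definition retained_blocks H (a : 'I_m) : set nat :=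
  [set i | ~ depends_on_preceding_rows H i a].

Definition has_kronecker_index H (a : 'I_m) (n : nat) : Prop :=
  (retained_blocks H a #= `I_n)%card.

Definition kronecker_systems (p : nat) : set (l2 R m) :=
  [set s | linear_systems s /\
    exists n : 'I_m -> nat, (forall a, has_kronecker_index s a (n a)) /\
      (\max_(a < m) n a)%N = p].

(* A(z) H(z) = B(z) as power series in z^-1, i.e. H = A^-1 B, where A_0 = I
   makes A(z) invertible. *)
Definition arma_model (q : nat) (A B : nat -> 'M[R]_m) H : Prop :=
  [/\ A 0%N = 1%:M, B 0%N = 1%:M,
      forall i, (q < i)%N -> A i = 0 /\ B i = 0 &
      forall k, \sum_(i < k.+1) A i *m H (k - i)%N = B k].

Definition arma_representable (q : nat) H : Prop :=
  exists A B, arma_model q A B H.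

Definition arma_irreducible_systems (p : nat) : set (l2 R m) :=
  [set s | [/\ linear_systems s, arma_representable p s &
    forall q, (q < p)%N -> ~ arma_representable q s]].

End LinearSystems.

Section Submanifold.
Context {R : realType} {E : normedModType R}.
Implicit Types (U V F M : set E) (f g : E -> E).

(* Continuity of the differential is with respect to the operator norm. *)
Definition C1_on U f : Prop := forall x, U x ->
  differentiable f x /\
  forall e : R, 0 < e ->
    \forall y \near x, forall v, `|'d f y v - 'd f x v| <= e * `|v|.

Definition C1_diffeo U V f g : Prop :=
  [/\ open U, open V,
      forall x, U x -> V (f x) /\ g (f x) = x,
      forall y, V y -> U (g y) /\ f (g y) = y &
      C1_on U f /\ C1_on V g].

Definition closed_subspace F : Prop :=
  [/\ closed F, F 0 & forall (a : R) u v, F u -> F v -> F (a *: u + v)].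

(* Existence of flattening charts; the model subspace F may depend on the point
   and may be infinite-dimensional. No complement of F is required: in a Hilbert
   space every closed subspace has one. *)
Definition is_C1_submanifold M : Prop := forall x, M x ->
  exists U V F f g,
    [/\ U x, C1_diffeo U V f g, closed_subspace F &
        f @` (U `&` M) = V `&` F].

End Submanifold.

(* Main.v *)
Require Import Defs.
From mathcomp Require Import all_boot all_order all_algebra complex.
From mathcomp Require Import zify ring.
From mathcomp Require Import all_classical all_reals all_analysis.

(** The two descriptions of the set agree because the block Hankel matrix is
shift invariant: once a row depends on the preceding ones, so do all the later
rows with the same component index.  The retained blocks of a component thus
form an initial segment, whose length is the Kronecker index, and all indices
are at most [q] exactly when every row of block [q] is a combination of the
rows of the blocks [< q].  The coefficients of these combinations are the
autoregressive matrices of an ARMA([q], [q]) model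
([arma_representable_kronecker]).

The set fails to be a submanifold because at a singular point its tangent
vectors span too much.  Take [H(z) = I + E00 z^-p], with Kronecker indices
[p, 0, ..., 0].  For every [|a| < 1] the whole line
[H + r (a z^-1 + a^2 z^-2 + ...) E11] lies in the set, since the perturbation
only raises the index of component 1 from 0 to at most [1 <= p]
([line_kronecker_systems]).  If the set were a submanifold, its tangent space
at [H] would be linear, and any finite sum [v] of these directions would be
tangent to a curve in the set ([submanifold_tangent_sum]).  But along the set
the [n x n] Hankel matrix of any single entry has rank at most [p m], hence a
zero determinant for [n = p m + 1] ([arma_det_hankel_mx]).  Entry [(1, 1)] of
the Markov parameters of [H] vanishes from index 1 on, so these determinants
are homogeneous along the curve and the Hankel determinant of [v] vanishes
too.  With [n] distinct nonzero values of [a], the Hankel matrix of [v]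
is [V D V^T] with [V] a Vandermonde matrix and [D] an invertible diagonal
matrix, so its determinant is nonzero ([det_hankel_mx_exp_neq0]). *)

Set Implicit Arguments.
Unset Strict Implicit.
Unset Printing Implicit Defensive.

Import Order.TTheory GRing.Theory Num.Theory.
Import numFieldNormedType.Exports.

(** * Kronecker indices and ARMA models *)

Section Hankel.
Local Open Scope classical_set_scope.
Local Open Scope ring_scope.
Context {R : realType} {m : nat}.
Implicit Types (H : nat -> 'M[R]_m).

(** Row [i + 1] of a component is row [i] with its first block dropped, so a
dependency relation shifts along with it; block 0 gets zero coefficients. *)
Lemma depends_on_preceding_rowsS H i a :
  depends_on_preceding_rows H i a -> depends_on_preceding_rows H i.+1 a.
Proof.
move=> [c e]; exists (fun k b => if k is k'.+1 then c k' b else 0).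
apply/funext => j; have -> : hankel_row H i.+1 a j = hankel_row H i a j.+1.
  by rewrite /hankel_row /hankel addnS.
have addE (f g : nat -> 'rV[R]_m) k : (f + g) k = f k + g k by [].
rewrite e !addE !fct_sumE; congr (_ + _); last first.
  by apply: eq_bigr => b _; rewrite !fctE /hankel_row /hankel addnS.
rewrite big_ord_recl [X in _ = X + _](_ : _ = 0) ?add0r; last first.
  by rewrite fct_sumE big1 // => b _; exact: scale0r.
apply: eq_bigr => k _; rewrite !fct_sumE; apply: eq_bigr => b _.
by rewrite !fctE /hankel_row /hankel addnS.
Qed.

Definition in_block_span H (q : nat) (h : nat -> 'rV[R]_m) : Prop :=
  exists c : nat -> 'I_m -> R,
    h = \sum_(k < q) \sum_(b < m) c k b *: hankel_row H k b.

Lemma in_block_spanD H q g h :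
  in_block_span H q g -> in_block_span H q h -> in_block_span H q (g + h).
Proof.
move=> [c ->] [d ->]; exists (fun k b => c k b + d k b).
rewrite -big_split; apply: eq_bigr => k _; rewrite -big_split.
by apply: eq_bigr => b _; rewrite scalerDl.
Qed.

Lemma in_block_spanZ H q (r : R) h :
  in_block_span H q h -> in_block_span H q (r *: h).
Proof.
move=> [c ->]; exists (fun k b => r * c k b).
rewrite scaler_sumr; apply: eq_bigr => k _; rewrite scaler_sumr.
by apply: eq_bigr => b _; rewrite scalerA.
Qed.

Lemma in_block_span_sum H q (I : finType) (P : pred I) F :
  (forall i, P i -> in_block_span H q (F i)) ->
  in_block_span H q (\sum_(i | P i) F i).
Proof.
move=> FP; apply: (big_ind (in_block_span H q)) => //; last first.
  by move=> g h; exact: in_block_spanD.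
exists (fun _ _ => 0); apply/esym.
by apply: big1 => k _; apply: big1 => b _; rewrite scale0r.
Qed.

(** A row may depend on earlier rows of its own block, but these depend in turn
on the preceding blocks: induction on the component index eliminates them. *)
Lemma depends_blockP H q :
  (forall a, depends_on_preceding_rows H q a) <->
  (forall a, in_block_span H q (hankel_row H q a)).
Proof.
split=> [dep a | spn a]; last first.
  have [c e] := spn a; exists (fun k b => if (k < q)%N then c k b else 0).
  rewrite [X in _ + X]big1 ?addr0 => [|b _]; last by rewrite ltnn scale0r.
  rewrite [LHS]e; apply: eq_bigr => k _; apply: eq_bigr => b _.
  by rewrite ltn_ord.
have [k ak] := ubnP (a : nat); elim: k => // k IH in a ak *.
have [c e] := dep a; rewrite e; apply: in_block_spanD; first by exists c.
apply: in_block_span_sum => b ba; apply: in_block_spanZ.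
by apply: IH; rewrite (leq_trans ba).
Qed.

(** The convolution [A * H] read as a combination of Hankel rows: [A_(q - k)]
holds the coefficients of block row [k]. *)
Lemma sum_ord_rev_mulmx (A : nat -> 'M[R]_m) H q j a :
  row a (\sum_(i < q) A i.+1 *m H (q + j - i)%N) =
  \sum_(k < q) \sum_(b < m) A (q - k)%N a b *: hankel_row H k b j.
Proof.
rewrite (reindex_inj rev_ord_inj) /= linear_sum; apply: eq_bigr => k _ /=.
rewrite subnSK ?ltn_ord// row_mul mulmx_sum_row; apply: eq_bigr => b _.
rewrite mxE /hankel_row /hankel; congr (_ *: row b (H _)).
have := ltn_ord k; lia.
Qed.

Lemma sum_ord_trunc (V : nmodType) (F : nat -> V) n k : (n <= k)%N ->
  (forall i, (n <= i)%N -> F i = 0) -> \sum_(i < k) F i = \sum_(i < n) F i.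
Proof.
move=> nk F0; rewrite (big_ord_widen k F nk) [RHS]big_mkcond /=.
by apply: eq_bigr => i _; case: ltnP => // /F0.
Qed.

(** The coefficients of [A H] of order [> q] form the relation expressing block
row [q] by the previous ones, with leading matrix [A_0 = I].  Conversely, such
relations define [A], and the truncation of [A H] then defines [B]. *)
Lemma arma_representableP q H :
  arma_representable q H <->
  H 0%N = 1%:M /\ forall a, depends_on_preceding_rows H q a.
Proof.
split=> [[A [B [A0 B0 AB0 AHB]]] | [H0 /depends_blockP/choice[c cE]]].
  split; first by have := AHB 0%N; rewrite big_ord1 A0 B0 mul1mx.
  apply/depends_blockP => a; exists (fun k b => - A (q - k)%N a b).
  apply/funext => j; have := AHB (q + j).+1.
  have [_ ->] := AB0 (q + j).+1 (leq_addr j q).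
  rewrite (sum_ord_trunc (F := fun i => A i *m H ((q + j).+1 - i)%N)
    (n := q.+1)) => [||i qi]; first last.
  - by have [-> _] := AB0 i qi; rewrite mul0mx.
  - by rewrite ltnS -addnS leq_addr.
  rewrite big_ord_recl /= A0 mul1mx subn0 => /eqP.
  rewrite addr_eq0 => /eqP /(congr1 (row a)).
  rewrite raddfN /= (sum_ord_rev_mulmx A H q j a) /hankel_row /hankel -addSn.
  move=> ->; rewrite -sumrN !fct_sumE; apply: eq_bigr => k _.
  rewrite -sumrN !fct_sumE; apply: eq_bigr => b _.
  by rewrite -scaleNr.
pose A i : 'M[R]_m := if i == 0%N then 1%:M else
  if (i <= q)%N then \matrix_(a, b) - c a (q - i)%N b else 0.
pose S k := \sum_(i < k.+1) A i *m H (k - i)%N.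
exists A, (fun k => if (k <= q)%N then S k else 0); split => //.
- by rewrite leq0n /S big_ord1 mul1mx H0.
- move=> i qi; have -> : A i = 0; last by rewrite leqNgt qi.
  by rewrite /A gtn_eqF ?(leq_ltn_trans _ qi)// leqNgt qi.
move=> k; case: leqP => // qk; rewrite -(subnKC qk); set j := (k - _)%N.
rewrite (sum_ord_trunc (F := fun i => A i *m H (q.+1 + j - i)%N)
  (n := q.+1)) => [||i qi]; first last.
- by rewrite /A gtn_eqF ?(leq_ltn_trans _ qi)// leqNgt qi mul0mx.
- by rewrite ltnS ltnW // ltnS leq_addr.
rewrite big_ord_recl /= mul1mx subn0; apply/eqP.
rewrite addr_eq0; apply/eqP/row_matrixP => a.
have := congr1 (fun f => f j) (cE a); rewrite {1}/hankel_row /hankel addSn => ->.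
rewrite raddfN /= (sum_ord_rev_mulmx A H q j a) -sumrN !fct_sumE.
apply: eq_bigr => k' _; rewrite -sumrN !fct_sumE; apply: eq_bigr => b _.
have kq := ltn_ord k'.
rewrite /A -scaleNr subn_eq0 leqNgt kq /= leq_subr mxE opprK subKn //.
exact: ltnW.
Qed.

Lemma retained_blocks_sub H q a :
  depends_on_preceding_rows H q a -> retained_blocks H a `<=` `I_q.
Proof.
move=> dep i /=; apply: contra_notP => /negP; rewrite -leqNgt => qi.
rewrite -(subnKC qi); elim: (i - q)%N => [|d IH]; first by rewrite addn0.
by rewrite addnS; exact: depends_on_preceding_rowsS.
Qed.

Lemma arma_representable_kronecker q H (n : 'I_m -> nat) :
  H 0%N = 1%:M -> (forall a, has_kronecker_index H a (n a)) ->
  arma_representable q H <-> (\max_(a < m) n a <= q)%N.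
Proof.
move=> H0 nH; split => [/arma_representableP[_ dep]|].
  apply/bigmax_leqP => a _; rewrite -card_le_II.
  rewrite -(card_le_eql (nH a)); apply: subset_card_le.
  exact: retained_blocks_sub.
move=> /bigmax_leqP nq; apply/arma_representableP; split => // a.
apply: contrapT => ret; have := nq a isT; apply/negP; rewrite -ltnNge.
rewrite -card_le_II -(card_le_eqr (nH a)); apply: subset_card_le => i /= iq.
by move=> /retained_blocks_sub/(_ q ret) /=; rewrite ltnNge -ltnS iq.
Qed.

Lemma has_kronecker_index_ex H q a : depends_on_preceding_rows H q a ->
  exists n, has_kronecker_index H a n.
Proof.
move=> dep; have ex : exists i, `[< depends_on_preceding_rows H i a >].
  by exists q; apply/asboolP.
case: (ex_minnP ex) => n /asboolP dn nmin; exists n.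
rewrite /has_kronecker_index (_ : retained_blocks H a = `I_n); first exact: card_eqxx.
apply/seteqP; split; first exact: retained_blocks_sub.
move=> i /= i_n di; have := nmin i (asboolT di).
by rewrite leqNgt i_n.
Qed.

Lemma arma_irreducible_systemsE p :
  @arma_irreducible_systems R m p = @kronecker_systems R m p.
Proof.
apply/seteqP; split => s.
  move=> [ls rep irr]; split => //; have [s0 _] := ls.
  have /arma_representableP[_ dep] := rep.
  have /choice[n nH] := fun a => has_kronecker_index_ex (dep a).
  exists n; split => //; have repE q := arma_representable_kronecker q s0 nH.
  apply/eqP; rewrite eqn_leq; apply/andP; split; first exact/repE.
  by rewrite leqNgt; apply/negP => /irr; apply; apply/repE.
move=> [ls [n [nH np]]]; have [s0 _] := ls.
have repE q := arma_representable_kronecker q s0 nH.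
split => //; first by apply/repE; rewrite np.
by move=> q qp /repE; rewrite np leqNgt qp.
Qed.

End Hankel.

(** * Tangent vectors and Hankel determinants *)

Section Tangent.
Local Open Scope classical_set_scope.
Local Open Scope ring_scope.
Context {R : realType} {E : normedModType R}.

Lemma near_line (U : set E) (x v : E) : open U -> U x ->
  \forall t \near (0 : R), U (t *: v + x).
Proof.
move=> oU Ux; have : (t *: v + x) @[t --> (0 : R)] --> 0 *: v + x.
  by apply: cvgD; [apply: cvgZr_tmp; exact: cvg_id | exact: cvg_cst].
rewrite scale0r add0r => /(_ U); apply; exact: open_nbhs_nbhs.
Qed.

(** In a flattening chart [f] each line becomes a curve in the closed subspace
[F], so [df (v i)] is in [F] and so is [w], the sum of these vectors.  The
segment from [f x] in direction [w], pulled back by [g], is the required curve: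
its velocity is [dg (df v) = v], where [v] is the sum of the [v i]. *)
Lemma submanifold_tangent_sum (M : set E) (x : E) (I : finType) (v : I -> E) :
  is_C1_submanifold M -> M x ->
  (forall i, \forall t \near (0 : R), M (t *: v i + x)) ->
  exists2 c : R -> E, \forall t \near (0 : R)^', M (c t) &
    t^-1 *: (c t - x) @[t --> (0 : R)^'] --> \sum_i v i.
Proof.
move=> subM Mx lineM.
have [U [V [F [f [g [Ux [oU oV fUV _ [C1f C1g]] [clF F0 linF] fUM]]]]]] :=
  subM x Mx.
have [Vfx gfx] := fUV x Ux.
have [df _] := C1f x Ux; have [dg _] := C1g _ Vfx.
have Ff u : U u -> M u -> F (f u).
  by move=> Uu Mu; have [] : (V `&` F) (f u) by rewrite -fUM; exists u.
have Fdf i : F ('d f x (v i)).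
  rewrite -deriveE //; apply: (closed_cvg (FF := Proper_dnbhs_numFieldType (0 : R)) F clF); last first.
    exact: (diff_derivable (v := v i) df).
  have near0 : \forall t \near (0 : R)^', F (f (t *: v i + x)).
    apply: nbhs_dnbhs; near=> t; apply: Ff.
      by near: t; exact: near_line.
    by near: t; exact: lineM.
  apply: filterS near0 => t Ft /=.
  rewrite -[X in F X]addr0; apply: (linF) => //.
  by rewrite addrC -scaleN1r; apply: (linF) => //; exact: Ff.
pose w := 'd f x (\sum_i v i).
have Fw : F w.
  rewrite /w linear_sum; apply: (big_ind F) => [//|a b Fa Fb|k _].
    by rewrite -[a]scale1r; exact: (linF).
  exact: Fdf.
exists (fun t => g (t *: w + f x)).
  apply: nbhs_dnbhs; near=> t.
  have [u [Uu Mu] fu] : (f @` (U `&` M)) (t *: w + f x).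
    rewrite fUM; split; last by apply: (linF) => //; exact: Ff.
    by near: t; exact: near_line.
  by rewrite -fu; have [_ ->] := fUV u Uu.
have -> : \sum_i v i = 'D_w g (f x).
  rewrite deriveE // /w.
  rewrite -[RHS]/(('d g (f x) \o 'd f x) (\sum_i v i)) -diff_comp // -deriveE.
    rewrite (@near_eq_derive _ _ _ (g \o f) id) ?derive_id //.
    have : nbhs x U by exact: open_nbhs_nbhs.
    by apply: filterS => u /fUV[].
  exact: differentiable_comp.
have := diff_derivable (v := w) dg.
by rewrite /derivable /derive /= gfx.
Unshelve. all: by end_near.
Qed.

End Tangent.

Section Determinant.
Local Open Scope classical_set_scope.
Local Open Scope ring_scope.
Context {R : realType}.

Lemma cvg_det (T : Type) (F : set_system T) (FF : Filter F) n
    (A : T -> 'M[R]_n) (B : 'M[R]_n) :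
  (forall i j, A t i j @[t --> F] --> B i j) -> \det (A t) @[t --> F] --> \det B.
Proof.
move=> AB; apply: cvg_big => [|s _]; first exact: add_continuous.
apply: cvgM; first exact: cvg_cst.
by apply: cvg_big => [|i _]; [exact: mul_continuous | exact: AB].
Qed.

(** As for the block Hankel matrix, the top left entry is the term of
index 1. *)
Definition hankel_mx (n : nat) (h : nat -> R) : 'M[R]_n :=
  \matrix_(i < n, j < n) h (i + j).+1.

(** The Hankel matrix of a sum of geometric sequences factors as
[V D V^T]. *)
Lemma det_hankel_mx_exp n (a : 'I_n -> R) :
  \det (hankel_mx n (fun k => \sum_l a l ^+ k)) =
  (\prod_l a l) * (\det (Vandermonde n (\row_l a l))) ^+ 2.
Proof.
pose V := Vandermonde n (\row_l a l).
have -> : hankel_mx n (fun k => \sum_l a l ^+ k) =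
    V *m diag_mx (\row_l a l) *m V^T.
  apply/matrixP => i j; rewrite !mxE; apply: eq_bigr => l _.
  by rewrite mul_mx_diag !mxE -exprSr -exprD addSn.
rewrite !det_mulmx det_tr det_diag mulrAC -expr2 mulrC; congr (_ * _).
by apply: eq_bigr => l _; rewrite mxE.
Qed.

Lemma det_hankel_mx_exp_neq0 n (a : 'I_n -> R) :
  injective a -> (forall l, a l != 0) ->
  \det (hankel_mx n (fun k => \sum_l a l ^+ k)) != 0.
Proof.
move=> a_inj a0; rewrite det_hankel_mx_exp mulf_neq0 ?expf_neq0 //.
  by apply/prodf_neq0 => l _.
rewrite det_Vandermonde; apply/prodf_neq0 => i _; apply/prodf_neq0 => j ij.
by rewrite !mxE subr_eq0 (inj_eq a_inj) -val_eqE gtn_eqF.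
Qed.

(** Block row [k] of the Hankel matrix, cut down to column [b] of its first [n]
block columns, is [W k].  By the autoregressive relation every [W k] is in the
row space [K] of the first [q] of them, which has dimension at most [q m]. *)
Lemma arma_det_hankel_mx m q (H : nat -> 'M[R]_m) n (a b : 'I_m) :
  arma_representable q H -> (q * m < n)%N ->
  \det (hankel_mx n (fun k => H k a b)) = 0.
Proof.
move=> [A [B [A0 _ AB0 AHB]]] qmn.
pose W k := \matrix_(c < m, j < n) H (k + j).+1 c b.
pose K : 'M[R]_n := (\sum_(k < q) <<W k>>)%MS.
have WK k : (W k <= K)%MS.
  have [N kN] := ubnP k; elim: N => // N IH in k kN *.
  have [kq|qk] := ltnP k q.
    by apply: (sumsmx_sup (Ordinal kq)) => //=; rewrite genmxE.
  have -> : W k = - \sum_(i < q) A i.+1 *m W (k - i.+1)%N.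
    apply/matrixP => c j; rewrite !mxE summxE.
    have [_ Bk] := AB0 (k + j).+1 (leq_trans qk (leq_addr _ _)).
    have := AHB (k + j).+1; rewrite Bk.
    rewrite (sum_ord_trunc (F := fun i => A i *m H ((k + j).+1 - i)%N)
      (n := q.+1)) => [||i qi]; first last.
    - by have [-> _] := AB0 i qi; rewrite mul0mx.
    - by rewrite ltnS ltnW // ltnS (leq_trans qk) // leq_addr.
    rewrite big_ord_recl /= A0 mul1mx subn0 => /eqP.
    rewrite addr_eq0 => /eqP ->; rewrite !mxE summxE; congr (- _).
    apply: eq_bigr => i _; rewrite !mxE; apply: eq_bigr => d _; rewrite !mxE.
    congr (_ * H _ _ _); have := ltn_ord i; rewrite /bump /=; lia.
  rewrite eqmx_opp; apply: summx_sub => i _; apply: mulmx_sub; apply: IH.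
  have := ltn_ord i; lia.
apply/eqP; rewrite -[_ == 0]negbK -unitfE -unitmxE -row_full_unit.
apply/negP => /eqP rk.
have : (\rank (hankel_mx n (fun k => H k a b)) <= \rank K)%N.
  apply: mxrankS; apply/row_subP => i.
  apply: submx_trans (WK i); apply: (eq_row_sub a).
  by apply/rowP => j; rewrite !mxE.
rewrite rk leqNgt => /negP; apply; apply: leq_ltn_trans qmn.
apply: leq_trans (mxrank_sum_leqif _) _ => /=.
rewrite -[X in (_ <= X * _)%N]card_ord -sum_nat_const; apply: leq_sum => k _.
by rewrite genmxE rank_leq_row.
Qed.

End Determinant.

(** * Coordinates and stable fractions *)

Section Coordinates.
Local Open Scope classical_set_scope.
Local Open Scope ring_scope.
Context {R : realType} {m : nat}.
Implicit Types (s : l2 R m).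

Lemma l2DE s1 s2 k : (s1 + s2) k = s1 k + s2 k.
Proof. by []. Qed.

Lemma l2ZE (r : R) s k : (r *: s) k = r *: s k.
Proof. by []. Qed.

Lemma l2BE s1 s2 k : (s1 - s2) k = s1 k - s2 k.
Proof. by []. Qed.

Lemma l2_sumE (I : finType) (v : I -> l2 R m) k : (\sum_i v i) k = \sum_i v i k.
Proof. by apply: (big_morph (fun s => s k)). Qed.

Lemma l2_coord_le s k a b : `|s k a b| <= `|s|.
Proof.
rewrite -sqrtr_sqr ler_wsqrtr //; apply: le_trans (frob_le_l2dot s k).
rewrite frobE (bigD1 a) //= (bigD1 b) //= -expr2 -addrA lerDl.
apply: addr_ge0; first by apply: sumr_ge0 => j _; rewrite -expr2 sqr_ge0.
by do 2![apply: sumr_ge0 => ? _]; rewrite -expr2 sqr_ge0.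
Qed.

Lemma cvg_l2_coord (T : Type) (F : set_system T) (FF : Filter F)
    (u : T -> l2 R m) s k a b :
  u t @[t --> F] --> s -> u t k a b @[t --> F] --> s k a b.
Proof.
move=> /cvgrPdist_le us; apply/cvgrPdist_le => e e0.
apply: filterS (us e e0) => t; apply: le_trans.
by have := l2_coord_le (s - u t) k a b; rewrite l2BE !mxE.
Qed.

Lemma sq_summable_finite (H : nat -> 'M[R]_m) q :
  (forall k, (q < k)%N -> H k = 0) -> H \in sq_summable.
Proof.
move=> H0; apply/asboolP.
apply: (is_cvg_near_cst (series (fun i => frob (H i) (H i)) q.+1)).
exists q.+1 => // n /= qn; rewrite /series /= (big_cat_nat _ qn) //=.
rewrite [X in _ + X]big1_seq ?addr0 // => i.
rewrite mem_index_iota => /and3P[_ qi _].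
by rewrite H0 // frobE big1 // => a _; rewrite big1 // => b _; rewrite mxE mul0r.
Qed.

End Coordinates.

Section StableFractions.
Local Open Scope ring_scope.
Context {R : realType}.
Implicit Types (h : nat -> R).

(** If [q] is the last index with [h_q] nonzero, the fraction is a polynomial with
constant term [h_q] over [z^q]: it is in lowest terms and its only possible
pole is 0. *)
Lemma stable_rational_finite h q :
  (forall k, (q < k)%N -> h k = 0) -> stable_rational h.
Proof.
elim: q => [|q IH] hq.
  exists (h 0%N)%:P, 1; split; rewrite ?oner_neq0 ?coprimep1 //; last first.
    by move=> z; rewrite rmorph1 rootC oner_eq0.
  split=> k; last by rewrite size_poly1 big_ord1 coefC eqxx mul1r hq.
  rewrite size_poly1 coefC; case: k => [|k].
    by rewrite big_nat1 coefC mul1r.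
  by rewrite big_geq.
have [hq0|hq0] := eqVneq (h q.+1) 0.
  apply: IH => k; rewrite leq_eqVlt => /orP[/eqP <- //|]; exact: hq.
exists (\poly_(k < q.+2) h (q.+1 - k)%N), 'X^(q.+1); split.
- by rewrite monic_neq0 // monicXn.
- rewrite coprimep_expr // coprimepX rootE horner_coef0 coef_poly /= subn0 //.
- split=> k; rewrite size_polyXn.
    rewrite coef_poly; case: ltnP => kq; last by rewrite big_geq.
    rewrite (big_cat_nat _ (n := q.+1)) //= big_nat1 coefXn eqxx mul1r.
    rewrite big_nat big1 ?add0r // => i /andP[_ iq].
    by rewrite coefXn ltn_eqF // mul0r.
  apply: big1 => i _; rewrite coefXn; case: eqP => [->|]; last by rewrite mul0r.
  by rewrite hq ?mulr0 // addnS ltnS leq_addr.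
move=> z; rewrite map_polyXn rootE hornerXn expf_eq0 /= => /eqP ->.
by rewrite normr0 ltr01.
Qed.

(** [1 + r a / (z - a) = (z - (a - r a)) / (z - a)], in lowest terms because
[r a] is nonzero. *)
Lemma stable_rational_geometric h (r a : R) : `|a| < 1 -> r * a != 0 ->
  h 0%N = 1 -> (forall k, h k.+1 = r * a ^+ k.+1) -> stable_rational h.
Proof.
move=> a1 ra h0 hS; exists ('X - (a - r * a)%:P), ('X - a%:P); split.
- by rewrite polyXsubC_eq0.
- by rewrite coprimep_XsubC2 // opprB addrC subrK.
- split=> k; rewrite size_XsubC; last first.
    rewrite big_ord_recl big_ord1 !coefB !coefX !coefC /= !hS !exprS; ring.
  case: k => [|[|k]].
  - rewrite big_ltn // big_nat1 !coefB !coefX !coefC /= h0 hS; ring.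
  - rewrite big_nat1 !coefB !coefX !coefC /= h0; ring.
  - rewrite big_geq // !coefB !coefX !coefC /=; ring.
move=> z; rewrite rmorphB /= map_polyX map_polyC /= root_XsubC => /eqP ->.
by rewrite normc_def /= expr0n addr0 sqrtr_sqr ltcR.
Qed.

End StableFractions.

(** * The singular point *)

Section SingularPoint.
Local Open Scope classical_set_scope.
Local Open Scope ring_scope.
Context {R : realType} {m : nat} (i0 i1 : 'I_m).

(** The transfer function [I + E00 z^-p] of the singular point, for
[p > 0]. *)
Definition delay_markov (p k : nat) : 'M[R]_m :=
  if k == 0%N then 1%:M else if k == p then delta_mx i0 i0 else 0.

(** The direction [(a z^-1 + a^2 z^-2 + ...) E11]. *)
Definition pole_markov (a : R) (k : nat) : 'M[R]_m :=
  if k == 0%N then 0 else a ^+ k *: delta_mx i1 i1.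

Lemma delay_markov_sq_summable p : delay_markov p \in sq_summable.
Proof.
apply: (@sq_summable_finite _ _ _ p) => k pk.
by rewrite /delay_markov !gtn_eqF // (leq_ltn_trans _ pk).
Qed.

Lemma pole_markov_sq_summable a : `|a| < 1 -> pole_markov a \in sq_summable.
Proof.
move=> a1; apply/asboolP.
have frobE' : frob (delta_mx i1 i1 : 'M[R]_m) (delta_mx i1 i1) = 1.
  rewrite /frob trmx_delta mul_delta_mx /mxtrace (bigD1 i1) //= mxE !eqxx.
  by rewrite big1 ?addr0 // => j /negbTE ji; rewrite mxE ji.
apply: (@series_le_cvg _ _ (geometric 1 (a ^+ 2))) => [k|k|k|].
- exact: frob_ge0.
- by rewrite geometric_ge0 // sqr_ge0.
- rewrite /pole_markov /= mul1r; case: k => [|k] /=.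
    by rewrite frobE big1 // => i _; rewrite big1 // => j _; rewrite mxE mul0r.
  by rewrite frobZl frobZr frobE' mulr1 -expr2 -!exprM mulnC.
- by apply: is_cvg_geometric_series; rewrite normrX expr_lt1.
Qed.

Definition delay_system p : l2 R m := L2 (delay_markov_sq_summable p).

Definition pole_direction a (a1 : `|a| < 1) : l2 R m :=
  L2 (pole_markov_sq_summable a1).

Context (i01 : i0 != i1).

Section Line.
Context (p : nat) (p_gt0 : (0 < p)%N) (a : R) (a1 : `|a| < 1) (r : R).

Let s := r *: pole_direction a1 + delay_system p.

Let s0 : s 0%N = 1%:M.
Proof. by rewrite l2DE l2ZE /= scaler0 add0r. Qed.

Let sS k : s k.+1 = (r * a ^+ k.+1) *: delta_mx i1 i1 +
  (if k.+1 == p then delta_mx i0 i0 else 0).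
Proof. by rewrite l2DE l2ZE /= scalerA. Qed.

Lemma line_linear_systems : linear_systems s.
Proof.
split=> // b c.
have [/andP[/eqP -> /eqP ->]|bc] := boolP ((b == i1) && (c == i1)); last first.
  apply: (@stable_rational_finite _ _ p) => -[//|k] pk.
  by rewrite sS (gtn_eqF pk) addr0 !mxE (negbTE bc) mulr0.
have sS11 k : s k.+1 i1 i1 = r * a ^+ k.+1.
  rewrite sS !mxE eqxx mulr1; case: ifP => _; rewrite !mxE ?addr0 //.
  by rewrite eq_sym (negbTE i01) addr0.
have [ra|ra] := eqVneq (r * a) 0.
  apply: (@stable_rational_finite _ _ 0) => -[//|k] _.
  by rewrite sS11 exprS mulrA ra mul0r.
by apply: (stable_rational_geometric a1 ra) => //; rewrite s0 mxE eqxx.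
Qed.

(** With [A(z) = I - a E11 z^-1] the product [A H] is a polynomial of degree [p]
in [z^-1]: the geometric tail is cancelled and [E11 E00 = 0]. *)
Lemma line_arma_representable : arma_representable p s.
Proof.
pose A i : 'M[R]_m := if i == 0%N then 1%:M else
  if i == 1%N then - a *: delta_mx i1 i1 else 0.
pose S k := \sum_(i < k.+1) A i *m s (k - i)%N.
exists A, (fun k => if (k <= p)%N then S k else 0); split => //.
- by rewrite /S big_ord1 mul1mx s0.
- move=> i pi; rewrite leqNgt pi /=; split => //.
  by rewrite /A !gtn_eqF // (leq_ltn_trans _ pi).
move=> k; case: leqP => // pk.
rewrite (sum_ord_trunc (F := fun i => A i *m s (k - i)%N) (n := 2)) //; last first.
- by move=> [|[|i]] //; rewrite mul0mx.
- by rewrite ltnS (leq_ltn_trans _ pk).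
have -> : \sum_(i < 2) A i *m s (k - i)%N = s k - a *: (delta_mx i1 i1 *m s k.-1).
  by rewrite big_ord_recl big_ord1 /A /= mul1mx subn0 subn1 -scalemxAl scaleNr.
case: k pk => [|[|k]] pk //; first by move: p_gt0 pk; lia.
rewrite [k.+2.-1]/= !sS (gtn_eqF pk) addr0 mulmxDr -scalemxAr mul_delta_mx.
have -> : delta_mx i1 i1 *m (if k.+1 == p then delta_mx i0 i0 else 0 : 'M[R]_m) = 0.
  by case: ifP; rewrite ?mulmx0 ?mul_delta_mx_0 // eq_sym.
rewrite addr0 scalerA -scalerBl [X in X *: _](_ : _ = 0) ?scale0r // !exprS.
ring.
Qed.

(** For [q < p], entry [(0, 0)] of the coefficient of order [p] of [A H] must
vanish; but column 0 of the Markov parameters is zero at indices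
[1, ..., p - 1], so that this entry is the one of [H_p], which is 1. *)
Lemma line_arma_irreducible q : (q < p)%N -> ~ arma_representable q s.
Proof.
move=> qp [A [B [A0 _ AB0 AHB]]]; have := AHB p; have [Ap ->] := AB0 p qp.
move=> /(congr1 (fun X : 'M[R]_m => X i0 i0)).
rewrite big_ord_recl A0 mul1mx subn0 mxE summxE big1 ?addr0 => [|i _].
  rewrite -[p]prednK // sS prednK // eqxx !mxE (negbTE i01) !eqxx mulr0 add0r.
  by move/eqP; rewrite oner_eq0.
rewrite lift0.
have [->|ip] := eqVneq i.+1 p; first by rewrite Ap mul0mx mxE.
have pi : (i.+1 < p)%N by rewrite ltn_neqAle ip ltn_ord.
rewrite -[(p - _)%N]prednK ?subn_gt0 // sS prednK ?subn_gt0 // ltn_eqF; last first.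
  by rewrite -subSn ?ltn_ord // subSS leq_subr.
rewrite addr0 -scalemxAr !mxE big1 ?mulr0 // => j _.
by rewrite !mxE (negbTE i01) andbF mulr0.
Qed.

Lemma line_kronecker_systems : kronecker_systems p s.
Proof.
rewrite -arma_irreducible_systemsE; split.
- exact: line_linear_systems.
- exact: line_arma_representable.
- exact: line_arma_irreducible.
Qed.

End Line.

(** The nodes [1 / (l + 2)], for [l < n = p m + 1], are distinct, nonzero and in
the unit disc; [n] exceeds the largest Hankel rank of an entry of a system in
the set. *)
Lemma kronecker_systems_not_submanifold p : (0 < p)%N ->
  ~ is_C1_submanifold (@kronecker_systems R m p).
Proof.
move=> p_gt0 subM; pose n := (p * m).+1.
pose a (l : 'I_n) : R := l.+2%:R^-1.
have a1 l : `|a l| < 1 by rewrite ger0_norm ?invr_ge0 // invf_lt1 ?ltr1n ?ltr0n.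
have a0 l : a l != 0 by rewrite invr_eq0 pnatr_eq0.
have a_inj : injective a.
  by move=> k l /invr_inj/eqP; rewrite eqr_nat !eqSS => /eqP/val_inj.
pose x := delay_system p; pose v l := pole_direction (a1 l).
have line l t : kronecker_systems p (t *: v l + x).
  exact: line_kronecker_systems.
have Mx : kronecker_systems p x by have := line ord0 0; rewrite scale0r add0r.
have [||c Mc cv] := @submanifold_tangent_sum _ _ _ x _ v subM.
- exact: Mx.
- by move=> l; apply: filterE => t; exact: line.
pose entry (s : l2 R m) k := s k i1 i1.
have := det_hankel_mx_exp_neq0 a_inj a0; move/eqP; apply.
have -> : hankel_mx n (fun k => \sum_l a l ^+ k) = hankel_mx n (entry (\sum_l v l)).
  apply/matrixP => i j; rewrite !mxE /entry l2_sumE summxE; apply: eq_bigr => l _.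
  by rewrite /= /pole_markov /= !mxE eqxx mulr1.
have det_cvg : \det (hankel_mx n (entry (t^-1 *: (c t - x)))) @[t --> (0 : R)^'] -->
    \det (hankel_mx n (entry (\sum_l v l))).
  apply: cvg_det => i j; rewrite mxE.
  under eq_fun do rewrite mxE.
  exact: cvg_l2_coord.
apply: (cvg_unique _ det_cvg) => //.
apply: cvg_near_cst; apply: filterS Mc => t Mct.
(* Homogeneity: [x] contributes nothing to this entry. *)
have -> : hankel_mx n (entry (t^-1 *: (c t - x))) = t^-1 *: hankel_mx n (entry (c t)).
  apply/matrixP => i j; rewrite !mxE /entry l2ZE l2BE !mxE /= /delay_markov /=.
  by case: ifP => _; rewrite !mxE ?[_ == i0]eq_sym ?(negbTE i01) subr0.
rewrite detZ; move: Mct; rewrite -arma_irreducible_systemsE => -[_ rep _].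
by rewrite (arma_det_hankel_mx i1 i1 rep) ?mulr0.
Qed.

End SingularPoint.

Theorem theorem3 (R : realType) (m p : nat) (hm : (2 <= m)%N) (hp : (1 <= p)%N) :
  @arma_irreducible_systems R m p = @kronecker_systems R m p /\
  ~ is_C1_submanifold (@kronecker_systems R m p).
Proof.
split; first exact: arma_irreducible_systemsE.
by apply: (@kronecker_systems_not_submanifold R m
  (Ordinal (ltnW hm)) (Ordinal hm)).
Qed.
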